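(* Let $f$ be a partial Boolean function and $\epsilon\ge0$. Then $\mathrm{R}_\epsilon(f)\ge\bar{\mathrm{R}}_\epsilon(f)\ge(1-2\epsilon)\mathrm{RS}(f)$.
   Context: A partial Boolean function on $n$ bits is $f:\mathrm{Dom}(f)\to\{0,1\}$ with $\mathrm{Dom}(f)\subseteq\{0,1\}^n$; query notions also apply to functions on alphabet $\{0,1,*,\dagger\}$, a query to position $i$ returning $x_i$. A randomized algorithm is a probability distribution over deterministic decision trees; it has error $\epsilon$ if on every input in the domain it is correct with probability at least $1-\epsilon$. $\mathrm{R}_\epsilon(h)$: minimum over error-$\epsilon$ algorithms of the worst-case number of queries (over inputs and trees in the support). $\bar{\mathrm{R}}_\epsilon(h)$: minimum over error-$\epsilon$ algorithms of the maximum over inputs of the expected number of queries. $\mathrm{R}_0(h)=\bar{\mathrm{R}}_0(h)$. Sabotage: $P_f\subseteq\{0,1,*\}^n$ is the set of $p$ for which there exist $x,y\in\mathrm{Dom}(f)$ with $f(x)\ne f(y)$ and $x_i=y_i=p_i$ whenever $p_i\ne*$; $P_f^\dagger$ is the same with $\dagger$ in place of $*$; $Q_f=P_f\cup P_f^\dagger$; $f_{\mathrm{sab}}:Q_f\to\{0,1\}$ is $0$ on $P_f$ and $1$ on $P_f^\dagger$. The randomized sabotage complexity is $\mathrm{RS}(f)=\mathrm{R}_0(f_{\mathrm{sab}})$. *)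

(* Defs.v *)
From HB Require Import structures.
From mathcomp Require Import all_boot all_order all_algebra.
From mathcomp Require Import all_classical all_reals all_analysis.

Set Implicit Arguments.
Unset Strict Implicit.
Unset Printing Implicit Defensive.

Import Order.TTheory GRing.Theory Num.Theory.

Local Open Scope classical_set_scope.
Local Open Scope ring_scope.

(* Partial Boolean functions on strings of length n over the alphabet A;
   None marks the strings outside the domain. *)
Definition pfun_str (A : Type) (n : nat) : Type := n.-tuple A -> option bool.

Definition pdom (A : Type) (n : nat) (h : pfun_str A n) : set (n.-tuple A) :=
  [set x | h x <> None].

(* Deterministic decision trees; a position may be queried again, and every
   query counts towards the cost. *)
Inductive dtree (A : Type) (n : nat) : Type :=
| Leaf of bool
| Query of 'I_n & (A -> dtree A n).

Arguments Leaf {A n}.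
Arguments Query {A n}.

Fixpoint dt_eval (A : Type) (n : nat) (t : dtree A n) (x : n.-tuple A) : bool :=
  match t with
  | Leaf b => b
  | Query i k => dt_eval (k (tnth x i)) x
  end.

Fixpoint dt_cost (A : Type) (n : nat) (t : dtree A n) (x : n.-tuple A) : nat :=
  match t with
  | Leaf _ => 0%N
  | Query i k => (dt_cost (k (tnth x i)) x).+1
  end.

(* The discrete sigma-algebra on trees. Over a finite alphabet there are only
   countably many trees, so a probability measure on it is exactly a discrete
   probability distribution over trees. *)
HB.instance Definition _ (A : Type) (n : nat) := gen_eqMixin (dtree A n).
HB.instance Definition _ (A : Type) (n : nat) := gen_choiceMixin (dtree A n).
HB.instance Definition _ (A : Type) (n : nat) :=
  isPointed.Build (dtree A n) (Leaf false).
HB.instance Definition _ (A : Type) (n : nat) :=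
  @isMeasurable.Build default_measure_display (dtree A n)
    discrete_measurable discrete_measurable0
    discrete_measurableC discrete_measurableU.

Definition has_error (R : realType) (A : Type) (n : nat) (eps : R)
    (h : pfun_str A n) (P : probability (dtree A n) R) : Prop :=
  forall x, pdom h x ->
    ((1 - eps)%:E <= P [set t | Some (dt_eval t x) = h x])%E.

(* In the two costs below, adjoining 0 only matters when h has empty domain,
   where the maximum over inputs is taken to be 0 (and not -oo). *)
Definition worst_cost (R : realType) (A : Type) (n : nat)
    (h : pfun_str A n) (P : probability (dtree A n) R) : \bar R :=
  ereal_sup (0%E |` [set c | exists x t,
    [/\ pdom h x, (0 < P [set t])%E & c = ((dt_cost t x)%:R)%:E]]).

Definition expected_cost (R : realType) (A : Type) (n : nat)
    (h : pfun_str A n) (P : probability (dtree A n) R) : \bar R :=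
  ereal_sup (0%E |`
    [set ('E_P[fun t => (dt_cost t x)%:R])%E | x in pdom h]).

Definition Rbar (R : realType) (A : Type) (n : nat) (eps : R)
    (h : pfun_str A n) : \bar R :=
  ereal_inf [set expected_cost h P | P in has_error eps h].

(* By convention the zero-error complexity R_0 is the expected one; the
   worst-case zero-error complexity would be the deterministic one. *)
Definition Rrand (R : realType) (A : Type) (n : nat) (eps : R)
    (h : pfun_str A n) : \bar R :=
  if eps == 0 then Rbar 0 h
  else ereal_inf [set worst_cost h P | P in has_error eps h].

Inductive symb : Type :=
| Bit of bool
| Star
| Dagger.

(* P_f for s = Star and P_f^dagger for s = Dagger. The condition forces every
   entry of p other than s to be a bit. *)
Definition sabotaged (n : nat) (f : pfun_str bool n) (s : symb) :
    set (n.-tuple symb) :=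
  [set p | exists x y, [/\ pdom f x, pdom f y, f x <> f y &
    forall i, tnth p i <> s ->
      Bit (tnth x i) = tnth p i /\ Bit (tnth y i) = tnth p i]].

(* The two sabotaged sets are disjoint, as a string of bits belongs to
   neither; so the order of the tests is irrelevant. *)
Definition fsab (n : nat) (f : pfun_str bool n) : pfun_str symb n :=
  fun p => if p \in sabotaged f Star then Some false
           else if p \in sabotaged f Dagger then Some true
           else None.

Definition RS (R : realType) (n : nat) (f : pfun_str bool n) : \bar R :=
  Rrand (0 : R) (fsab f).

(* Main.v *)
(* Given an algorithm P for f and a zero-error algorithm Q for f_sab, run P on
   the sabotaged string and stop at the first entry that is not a bit; if P
   halts without meeting one, run Q. Let x and y be inputs with different
   f-values that agree with the string off its marked entries. Before meeting a
   mark the run coincides with the runs of P on x and on y, so it costs no more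
   than P on x, and Q is needed only if P gives x and y the same answer, which
   has probability at most 2 eps. Hence RS <= cost(P) + 2 eps cost(Q), and Q may
   be taken arbitrarily close to optimal. This replaces the usual restarting of
   P, whose unbounded runs are not finite trees, by a fixed-point inequality. *)
From HB Require Import structures.
Require Import Defs.
From mathcomp Require Import all_boot all_order all_algebra.
From mathcomp Require Import all_classical all_reals all_analysis.
From mathcomp Require Import measurable_realfun giry lra.

Import Order.TTheory GRing.Theory Num.Theory.

Local Open Scope ring_scope.

Set Implicit Arguments.
Unset Strict Implicit.

Local Open Scope classical_set_scope.
Local Open Scope ereal_scope.

(** * Integration over random trees *)

Lemma integral_prob_cst d (T : measurableType d) (R : realType)
    (P : probability T R) (c : \bar R) : \int[P]_t c = c.
Proof.
by rewrite (integral_cst P measurableT c) /= probability_setT mule1.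
Qed.

(** The Giry constructions yield subprobabilities; total mass 1 upgrades them. *)
Lemma probability_of_subprobability d (T : measurableType d) (R : realType)
    (mu : subprobability T R) : mu setT = 1 ->
  exists M : probability T R,
    forall h : T -> \bar R, \int[M]_t h t = \int[mu]_t h t.
Proof.
move=> mu1; pose isP := isProbability.Build _ _ _ (mu : set T -> \bar R) mu1.
pose M : probability T R := HB.pack (mu : set T -> \bar R) mu isP.
by exists M.
Qed.

Section dtree_measure.
Variables (A : Type) (n : nat) (R : realType).

Lemma dtree_measurable (S : set (dtree A n)) : measurable S.
Proof. by []. Qed.

Lemma dtree_measurable_fun d (T : measurableType d) (g : dtree A n -> T) :
  measurable_fun setT g.
Proof. by move=> _ S _; exact: dtree_measurable. Qed.

Lemma expectationE (P : probability (dtree A n) R) (X : dtree A n -> R) :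
  'E_P[X] = \int[P]_t (X t)%:E.
Proof. by rewrite unlock. Qed.

Lemma prob_indic (P : probability (dtree A n) R) (S : set (dtree A n)) :
  P S = \int[P]_t (\1_S t)%:E.
Proof. by rewrite integral_indic// setIT. Qed.

End dtree_measure.

Section mixture.
Variables (A B C : Type) (n : nat) (R : realType).

(** [M] is the law of [g t s] for independent [t] and [s]: push [Q] forward along [g t], then bind
    over [P]. *)
Lemma mixture_exists (g : dtree A n -> dtree B n -> dtree C n)
    (P : probability (dtree A n) R) (Q : probability (dtree B n) R) :
  exists M : probability (dtree C n) R, forall h : dtree C n -> \bar R,
    (forall t, 0 <= h t) ->
    \int[M]_u h u = \int[P]_t \int[Q]_s h (g t s).
Proof.
pose k t : giry (dtree C n) R :=
  giry_map (@dtree_measurable_fun _ _ _ _ (g t)) Q.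
pose mu := giry_bind (P : giry _ R) (@dtree_measurable_fun _ _ _ _ k).
have muE h : (forall t, 0 <= h t) ->
    \int[mu]_u h u = \int[P]_t \int[Q]_s h (g t s).
  move=> h0.
  have mh : measurable_fun setT h by exact: dtree_measurable_fun.
  have := giry_int_bind (P : giry _ R) (@dtree_measurable_fun _ _ _ _ k) mh h0.
  rewrite /giry_int -/mu => ->.
  apply: eq_integral => t _.
  exact: (giry_int_map (@dtree_measurable_fun _ _ _ _ (g t)) Q mh h0).
have mu1 : mu setT = 1.
  have -> : mu setT = \int[mu]_u (cst 1) u by rewrite integral_cst// mul1e.
  rewrite muE//.
  by rewrite (eq_integral (cst 1)) => [|t _]; rewrite integral_prob_cst.
have [M ME] := probability_of_subprobability mu1.
by exists M => h h0; rewrite ME muE.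
Qed.

End mixture.

(** * Countability of trees, and expected against worst-case cost *)

Fixpoint dtree_encode (A : finType) n (t : dtree A n) :
    GenTree.tree (bool + 'I_n) :=
  match t with
  | Leaf b => GenTree.Leaf (inl b)
  | Query i k =>
      GenTree.Node 0 (GenTree.Leaf (inr i) ::
        [seq dtree_encode (k a) | a <- enum A])
  end.

(** Since [A] is finite, the list of encoded children determines the branching function at every
    letter. *)
Lemma dtree_encode_inj (A : finType) n : injective (@dtree_encode A n).
Proof.
elim=> [b|i k IH] [c|j l] //=; first by case=> ->.
case=> <- /eq_in_map kl; congr Query; apply/funext => a.
by apply: IH; apply: kl; rewrite mem_enum.
Qed.

Section costs.
Variables (R : realType) (A : Type) (n : nat) (h : pfun_str A n).
Implicit Types P : probability (dtree A n) R.

Lemma expected_cost_ge0 P : 0 <= expected_cost h P.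
Proof. by apply: ereal_sup_ubound; left. Qed.

Lemma Rbar_ge0 (eps : R) : 0 <= Rbar eps h.
Proof. by apply/ereal_infP => _ [P _ <-]; exact: expected_cost_ge0. Qed.

Lemma le_expected_cost P x : pdom h x ->
  \int[P]_t (dt_cost t x)%:R%:E <= expected_cost h P.
Proof.
by move=> hx; apply: ereal_sup_ubound; right; exists x; rewrite ?expectationE.
Qed.

Lemma expected_cost_le P (c : \bar R) : 0 <= c ->
  (forall x, pdom h x -> \int[P]_t (dt_cost t x)%:R%:E <= c) ->
  expected_cost h P <= c.
Proof.
move=> c0 H; apply/ereal_supP => _ [->//|[x hx <-]].
by rewrite expectationE; exact: H.
Qed.

End costs.

(* Trees of probability 0 do not count in [worst_cost]; there are countably many
   trees, so together they form a null set. *)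
Lemma expected_le_worst_cost (R : realType) (A : finType) n
    (h : pfun_str A n) (P : probability (dtree A n) R) :
  expected_cost h P <= worst_cost h P.
Proof.
have w0 : 0 <= worst_cost h P by apply: ereal_sup_ubound; left.
apply: expected_cost_le => // x hx.
rewrite -(integral_prob_cst P (worst_cost h P)).
apply: ae_ge0_le_integral => //.
(* Sorting the null trees by code makes their union countable; by injectivity each [N k] has at most
   one element. *)
pose N k := [set t | P [set t] = 0 /\ pickle (dtree_encode t) = k].
have [|Z [_ Z0 NZ]] := @negligible_bigcup _ _ _ P N.
  move=> k; exists (N k); split => //.
  have [->|/set0P [t [Pt tk]]] := eqVneq (N k) set0; first exact: measure0.
  rewrite (_ : N k = [set t])//; apply/seteqP; split => [s [_ sk]|_ ->//].
  by apply: dtree_encode_inj; apply: (pcan_inj pickleK); rewrite sk.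
exists Z; split => // t /=.
apply: contra_notP => Zt _; apply: ereal_sup_ubound; right.
exists x, t; split => //.
rewrite lt0e measure_ge0 andbT; apply/eqP => Pt; apply/Zt/NZ.
by exists (pickle (dtree_encode t)).
Qed.

Lemma Rbar_le_Rrand (R : realType) (A : finType) n (h : pfun_str A n)
    (eps : R) : Rbar eps h <= Rrand eps h.
Proof.
rewrite /Rrand; case: eqP => [->//|_].
apply/ereal_infP => _ [P hP <-]; apply: ge_ereal_inf.
by exists (expected_cost h P); [exists P|exact: expected_le_worst_cost].
Qed.

(** * Trees that search a sabotaged string for a mark *)

Definition mark (c : bool) : symb := if c then Dagger else Star.

(** The answer at a leaf of [t] is discarded: reaching it only means that no mark was met. *)
Fixpoint seek_then n (t : dtree bool n) (s : dtree symb n) : dtree symb n :=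
  match t with
  | Leaf _ => s
  | Query i k => Query i (fun a =>
      match a with
      | Bit b => seek_then (k b) s
      | Star => Leaf false
      | Dagger => Leaf true
      end)
  end.

(** Run on all positions, this is a zero-error algorithm of bounded cost. Its final leaf is a
    default, never reached on a sabotaged string. *)
Fixpoint scan n (r : seq 'I_n) : dtree symb n :=
  match r with
  | [::] => Leaf false
  | i :: r' => Query i (fun a =>
      match a with
      | Bit _ => scan r'
      | Star => Leaf false
      | Dagger => Leaf true
      end)
  end.

Definition masks n (c : bool) (p : n.-tuple symb) (x : n.-tuple bool) :=
  forall i, tnth p i = mark c \/ tnth p i = Bit (tnth x i).

Section sabotage.
Variables (n : nat) (c : bool) (p : n.-tuple symb) (x : n.-tuple bool).
Hypothesis px : masks c p x.

Lemma dt_eval_seek_then t s :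
  dt_eval s p = c -> dt_eval (seek_then t s) p = c.
Proof.
move=> sp; elim: t => [//|i k IH] /=.
by have [->|->] := px i; [case: (c)|exact: IH].
Qed.

(* A run that does not meet the mark follows both [x] and [y]. *)
Lemma dt_cost_seek_then y t s : masks c p y ->
  (dt_cost (seek_then t s) p <=
   dt_cost t x + (dt_eval t x == dt_eval t y) * dt_cost s p)%N.
Proof.
move=> py; elim: t => [b|i k IH] /=; first by rewrite eqxx mul1n.
have [->|pix] := px i; first by case: (c).
rewrite pix; have [piy|] := py i; first by move: pix; rewrite piy; case: (c).
by rewrite pix; case=> <-; rewrite addSn ltnS; exact: IH.
Qed.

Lemma dt_eval_scan i r : i \in r -> tnth p i = mark c ->
  dt_eval (scan r) p = c.
Proof.
move=> + pi; elim: r => [//|j r IH]; rewrite inE => /orP ij /=.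
have [->|pj] := px j; first by case: (c).
rewrite pj; case: ij => [/eqP ij|]; last exact: IH.
by move: pj; rewrite -ij pi; case: (c).
Qed.

Lemma dt_cost_scan r : (dt_cost (scan r) p <= size r)%N.
Proof. by elim: r => [//|i r IH] /=; case: (tnth p i). Qed.

End sabotage.

(** * Bounds on the sabotage complexity *)

Section fsab.
Variables (n : nat) (f : pfun_str bool n).
Implicit Types p : n.-tuple symb.

Lemma fsab_witness p : pdom (fsab f) p -> exists c x y,
  [/\ fsab f p = Some c, pdom f x, pdom f y, f x <> f y &
      masks c p x /\ masks c p y].
Proof.
move=> pp; have [c [pc [x [y [dx dy fxy xy]]]]] :
    exists c, fsab f p = Some c /\ sabotaged f (mark c) p.
  move: pp; rewrite /pdom /fsab /=.
  case: ifPn => [/set_mem ps _|_]; first by exists false.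
  by case: ifPn => [/set_mem ps _|//]; exists true.
exists c, x, y; split => //.
by split=> i; have [|/xy[]] := pselect (tnth p i = mark c);
  [left|right|left|right].
Qed.

Lemma scan_correct p : pdom (fsab f) p ->
  Some (dt_eval (scan (enum 'I_n)) p) = fsab f p.
Proof.
move=> /fsab_witness[c [x [y [-> _ _ fxy [px py]]]]]; congr Some.
have [[i pi]|nop] := pselect (exists i, tnth p i = mark c).
  by apply: (dt_eval_scan px _ pi); rewrite mem_enum.
(* Without a mark, [p] would spell out both [x] and [y], forcing [f x = f y]. *)
case: fxy; congr f; apply: eq_from_tnth => i.
have [pi|pix] := px i; first by case: nop; exists i.
have [pi|] := py i; first by case: nop; exists i.
by rewrite pix => -[].
Qed.

Variable R : realType.

Lemma RSE : RS R f = Rbar 0 (fsab f).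
Proof. by rewrite /RS /Rrand eqxx. Qed.

(** Finiteness is what allows [RS R f] to be moved across the fixed-point inequality. *)
Lemma RS_lt_pinfty : RS R f < +oo.
Proof.
pose P : probability (dtree symb n) R := \d_(scan (enum 'I_n)).
rewrite RSE.
apply: (@le_lt_trans _ _ n%:R%:E); last exact: ltry.
apply: ge_ereal_inf; exists (expected_cost (fsab f) P).
  exists P => // p pp; rewrite subr0 /P /= diracE mem_set//=.
  exact: scan_correct.
apply: expected_cost_le => [|p pp]; first by rewrite lee_fin.
rewrite integral_dirac// diracT mul1e lee_fin ler_nat.
by rewrite (leq_trans (dt_cost_scan _ _))// size_enum_ord.
Qed.

(** A tree giving [x] and [y] the same answer errs on one of them; the union bound concludes. *)
Lemma prob_agree (eps : R) (P : probability (dtree bool n) R) x y :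
  has_error eps f P -> pdom f x -> pdom f y -> f x <> f y ->
  P [set t | dt_eval t x = dt_eval t y] <= (2 * eps)%:E.
Proof.
move=> hP dx dy fxy.
pose bad z := ~` [set t : dtree bool n | Some (dt_eval t z) = f z].
have bad_le z : pdom f z -> P (bad z) <= eps%:E.
  move=> /hP hz; rewrite probability_setC; last exact: dtree_measurable.
  by rewrite leeBlDr ?fin_num_measure// -leeBlDl//.
apply: (@le_trans _ _ (P (bad x `|` bad y))).
  apply: le_measure; rewrite ?inE //=; try exact: dtree_measurable.
  move=> t /= txy.
  have [fx|] := pselect (Some (dt_eval t x) = f x); last by left.
  have [fy|] := pselect (Some (dt_eval t y) = f y); last by right.
  by case: fxy; rewrite -fx -fy txy.
apply: (le_trans (measureU2 _ _ _)); try exact: dtree_measurable.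
by rewrite mulr2n mulrDl mul1r EFinD leeD// bad_le.
Qed.

Lemma RS_le (eps : R) (P : probability (dtree bool n) R)
    (Q : probability (dtree symb n) R) :
  (0 <= eps)%R -> has_error eps f P -> has_error 0 (fsab f) Q ->
  RS R f <= expected_cost f P + (2 * eps)%:E * expected_cost (fsab f) Q.
Proof.
move=> eps0 hP hQ; have [M ME] := mixture_exists (@seek_then n) P Q.
set C := expected_cost f P; set D := expected_cost (fsab f) Q.
have D0 : 0 <= D by exact: expected_cost_ge0.
have C0 : 0 <= C by exact: expected_cost_ge0.
have key p : pdom (fsab f) p ->
    \int[M]_u (dt_cost u p)%:R%:E <= C + (2 * eps)%:E * D.
  move=> pp; have [c [x [y [pc dx dy fxy [px py]]]]] := fsab_witness pp.
  pose E := [set t : dtree bool n | dt_eval t x = dt_eval t y].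
  pose q := \int[Q]_s (dt_cost s p)%:R%:E.
  have q0 : 0 <= q by apply: integral_ge0 => s _; rewrite lee_fin.
  have qD : q <= D by exact: le_expected_cost.
  rewrite ME; last by move=> t; rewrite lee_fin.
  (* Integrating over [s] first turns the cost of the second phase into the constant [q], as [E]
     depends on [t] alone. *)
  apply: (@le_trans _ _ (\int[P]_t ((dt_cost t x)%:R%:E + (\1_E t)%:E * q))).
    apply: ge0_le_integral => //.
      by move=> t _; apply: integral_ge0 => s _; rewrite lee_fin.
    move=> t _.
    apply: (@le_trans _ _ (\int[Q]_s ((dt_cost t x)%:R%:E +
        (\1_E t)%:E * (dt_cost s p)%:R%:E))).
      apply: ge0_le_integral => //.
      move=> s _; rewrite -EFinM -EFinD lee_fin indicE -natrM -natrD ler_nat.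
      rewrite (_ : t \in E = (dt_eval t x == dt_eval t y)).
        exact: dt_cost_seek_then px _ _ _ py.
      by apply/idP/eqP; rewrite inE.
    by rewrite ge0_integralD// integral_prob_cst ge0_integralZl_EFin.
  rewrite ge0_integralD// => [|t _]; last by rewrite mule_ge0.
  rewrite ge0_integralZr// -prob_indic leeD//; first exact: le_expected_cost.
  by apply: lee_pmul => //; exact: prob_agree hP dx dy fxy.
rewrite RSE; apply: ge_ereal_inf; exists (expected_cost (fsab f) M).
  exists M => // p pp; have := hQ p pp.
  have [c [x [y [pc dx dy fxy [px py]]]]] := fsab_witness pp.
  rewrite subr0 => hq; rewrite prob_indic ME; last by move=> t; rewrite lee_fin.
  rewrite -(integral_prob_cst P 1%:E).
  apply: ge0_le_integral => //.
  (* For every fixed [t], [seek_then t s] is correct whenever [s] is. *)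
  move=> t _; apply: (le_trans hq); rewrite prob_indic.
  apply: ge0_le_integral => //.
  move=> s _; rewrite lee_fin !indicE ler_nat.
  have [sp|_] := boolP (s \in _); last by [].
  rewrite mem_set//=; move: sp; rewrite inE /= pc => -[sp].
  by congr Some; exact: (dt_eval_seek_then px).
by apply: expected_cost_le key; rewrite adde_ge0// mule_ge0// lee_fin mulr_ge0.
Qed.

End fsab.

Local Close Scope ereal_scope.
Local Close Scope classical_set_scope.
Unset Implicit Arguments.
Set Strict Implicit.

Theorem theorem12 (R : realType) (n : nat) (f : pfun_str bool n) (eps : R)
    (heps : 0 <= eps) :
  (Rbar eps f <= Rrand eps f)%E /\
  ((1 - 2 * eps)%:E * RS R f <= Rbar eps f)%E.
Proof.
split; first exact: Rbar_le_Rrand.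
have RS0 : (0 <= RS R f)%E by rewrite RSE; exact: Rbar_ge0.
apply/ereal_infP => _ [P hP <-]; have C0 := expected_cost_ge0 f P.
(* For [eps] at least 1/2 the left side is nonpositive. *)
have [eps2|eps2] := leP (1 - 2 * eps) 0.
  by apply: le_trans C0; apply: mule_le0_ge0; rewrite ?lee_fin.
have RSfin : RS R f \is a fin_num by rewrite ge0_fin_numE// RS_lt_pinfty.
have RSle Q := @RS_le n f R eps P Q heps hP.
case: (expected_cost f P) C0 RSle => [C||//] C0 RSle; last by rewrite leey.
apply/lee_addgt0Pr => d d0.
(* Choose [Q] of cost [D < RS + d]. Then [RS <= C + 2 * eps * D] gives
   [(1 - 2 * eps) * RS <= C + 2 * eps * d], and [2 * eps < 1] here. *)
have : (Rbar 0 (fsab f) < RS R f + d%:E)%E by rewrite -RSE lteDl.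
move=> /ereal_inf_ltP[_ [Q hQ <-] QV].
have D0 := expected_cost_ge0 (fsab f) Q; have := RSle Q hQ.
move: RS0 QV; rewrite -(fineK RSfin).
case: (expected_cost (fsab f) Q) D0 => [D| |] //= D0.
rewrite -!EFinM -!EFinD !lee_fin !lte_fin => V0 DV VD.
nra.
Qed.
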